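(* Let $\mathfrak p$ be a property (of unordered hypergraphs, or of ordered hypergraphs) that allows $T_0$-filtration, and let $m\ge 0$, $n\ge 1$ be integers. Then $$\alpha_{\mathfrak p}(m,n)=\sum_{i=1}^{n}S_{n,i}\,\alpha^\ast_{\mathfrak p}(m,i),$$ where $S_{n,i}$ are the Stirling numbers of the second kind.
   Context: A (labelled) $(m,n)$-hypergraph $H$ consists of a linearly ordered vertex set $V=\{V[1]<\dots<V[n]\}$ with $n\ge1$ elements together with a finite family of $m$ subsets of $V$, called edges, which may be empty and may repeat. $H$ is ordered if the family is a sequence $(e_1,\dots,e_m)$, and unordered if the family is considered up to re-indexing (a multiset of $m$ subsets of $V$). Two hypergraphs are identified if the order-preserving bijection of their vertex sets carries one family to the other, so one counts $(m,n)$-hypergraphs on a fixed linearly ordered $n$-set. A hypergraph property is a property of such hypergraphs (all ordered, or all unordered), invariant under this identification. For vertices $u,v$ of $H$ write $u\sim_H v$ if every edge of $H$ contains either both or neither of $u,v$. $H$ is a $T_0$-hypergraph if $u\not\sim_H v$ for all distinct vertices $u,v$. $\alpha_{\mathfrak p}(m,n)$ is the number of $(m,n)$-hypergraphs with property $\mathfrak p$, and $\alpha^\ast_{\mathfrak p}(m,n)$ is the number of those which are $T_0$-hypergraphs. For a partition $\pi$ of $\{1,\dots,n\}$, $\alpha_{\mathfrak p}(m,n;\pi)$ is the number of $(m,n)$-hypergraphs $H$ with property $\mathfrak p$ such that $V[i]\sim_H V[j]$ whenever $i,j$ lie in the same class of $\pi$. The property $\mathfrak p$ is a regular $T_0$-property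 if, for all $m,n$, the value $\alpha_{\mathfrak p}(m,n;\pi)$ depends only on the number $k$ of classes of $\pi$; it is then denoted $\alpha_{\mathfrak p}(m,n;k)$. A regular $T_0$-property $\mathfrak p$ allows $T_0$-filtration if $\alpha_{\mathfrak p}(m,n;k)=\alpha_{\mathfrak p}(m,k)$ for every $k\in\{1,\dots,n\}$ (for all $m,n$). $S_{n,i}$ is the number of partitions of an $n$-set into $i$ non-empty classes. *)

(* Defs.v *)
From mathcomp Require Import all_boot.

Set Implicit Arguments.
Unset Strict Implicit.
Unset Printing Implicit Defensive.

(* Hypergraphs are identified along order-preserving bijections of their       *)
(* vertex sets, so an (m, n)-hypergraph is represented on the vertex set 'I_n, *)
(* and every predicate on this representation is invariant.                    *)

Definition ordered_hypergraph (m n : nat) : finType := m.-tuple {set 'I_n}.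

(* A multiset of m subsets, given by its multiplicity function; multiplicities *)
(* cannot exceed m since they add up to m.                                     *)
Definition unordered_hypergraph (m n : nat) : finType :=
  {mu : {ffun {set 'I_n} -> 'I_m.+1} | \sum_(e : {set 'I_n}) mu e == m}.

Inductive hkind := Ordered | Unordered.

Definition hypergraph (K : hkind) (m n : nat) : finType :=
  match K with
  | Ordered => ordered_hypergraph m n
  | Unordered => unordered_hypergraph m n
  end.

Definition is_edge (K : hkind) (m n : nat) :
    hypergraph K m n -> pred {set 'I_n} :=
  match K return hypergraph K m n -> pred {set 'I_n} with
  | Ordered => fun (H : m.-tuple {set 'I_n}) e => e \in H
  | Unordered => fun (H : unordered_hypergraph m n) e => 0 < val H e
  end.

Definition hproperty (K : hkind) := forall m n : nat, pred (hypergraph K m n).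

Section Counting.

Variable K : hkind.

Definition vsim (m n : nat) (H : hypergraph K m n) : rel 'I_n :=
  fun u v => [forall e, is_edge H e ==> ((u \in e) == (v \in e))].

Definition is_T0 (m n : nat) (H : hypergraph K m n) : bool :=
  [forall u, forall v, (u != v) ==> ~~ vsim H u v].

Variable p : hproperty K.

Definition alpha (m n : nat) : nat := #|[set H : hypergraph K m n | p H]|.

Definition alpha_T0 (m n : nat) : nat :=
  #|[set H : hypergraph K m n | p H & is_T0 H]|.

Definition alpha_part (m n : nat) (P : {set {set 'I_n}}) : nat :=
  #|[set H : hypergraph K m n |
      p H & [forall B in P, forall i in B, forall j in B, vsim H i j]]|.

Definition regular_T0 : Prop :=
  forall (m n : nat) (P Q : {set {set 'I_n}}), 0 < n ->
    partition P [set: 'I_n] -> partition Q [set: 'I_n] -> #|P| = #|Q| ->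
    alpha_part m P = alpha_part m Q.

(* The common value alpha(m, n; k) of a regular property is the value of       *)
(* alpha_part at any partition with k classes.                                 *)
Definition allows_T0_filtration : Prop :=
  regular_T0 /\
  forall m n k : nat, 0 < n -> 1 <= k <= n ->
    forall P : {set {set 'I_n}}, partition P [set: 'I_n] -> #|P| = k ->
    alpha_part m P = alpha m k.

End Counting.

Definition stirling2 (n i : nat) : nat :=
  #|[set P : {set {set 'I_n}} | partition P [set: 'I_n] & #|P| == i]|.

(* Main.v *)
Require Import Defs.
From mathcomp Require Import all_boot.

(* Sorting the hypergraphs with property p by the partition of their vertices
   into ~_H-classes, let e(P) be the number of those whose partition is P. Then
   alpha(m, n; P) is the sum of e(Q) over the partitions Q coarser than P, and
   these correspond to the partitions of a set of #|P| elements. Comparing with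
   alpha(m, #|P|), which is the sum of e(R) over all the partitions R of such a
   set, strong induction on #|P| gives e(P) = alpha_T0(m, #|P|): all terms but
   those of the finest partitions cancel, and e of the partition into singletons
   counts the T0-hypergraphs. Summing e(P) over all P proves the theorem. *)

Set Implicit Arguments.
Unset Strict Implicit.
Unset Printing Implicit Defensive.

(** * Cardinalities of images when one map factors through another *)

Section FactorImset.

Variables (aT rT sT : finType) (f : aT -> rT) (g : aT -> sT) (A : {set aT}).
Hypothesis fg : forall x y, f x = f y -> g x = g y.

Lemma factor_imset :
  exists h : rT -> option sT,
    (forall x, h (f x) = Some (g x)) /\ #|g @: A| = #|h @: (f @: A)|.
Proof.
(* By [fg] the choice of preimage does not affect the value; outside the range of [f] the value is
   [None], as [sT] may be empty. *)
pose h u := omap g [pick x | f x == u].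
have hf x : h (f x) = Some (g x).
  by rewrite /h; case: pickP => [y /eqP /fg <- | /(_ x)] //; rewrite eqxx.
exists h; split=> //; rewrite -(card_imset (g @: A) (fun x y => @Some_inj _ x y)).
by rewrite -!imset_comp; congr #|pred_of_set _|; apply: eq_imset => x /=.
Qed.

Lemma leq_card_factor_imset : #|g @: A| <= #|f @: A|.
Proof. by have [h [_ ->]] := factor_imset; apply: leq_imset_card. Qed.

Lemma eq_card_factor_imset :
  #|g @: A| = #|f @: A| -> {in A &, forall x y, g x = g y -> f x = f y}.
Proof.
have [h [hf ->]] := factor_imset => /eqP/imset_injP hinj x y Ax Ay gxy.
by apply: hinj; rewrite ?imset_f // !hf gxy.
Qed.

End FactorImset.

Lemma eq_card_kernel_imset (aT rT sT : finType) (f : aT -> rT) (g : aT -> sT)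
    (A : {set aT}) :
  (forall x y, (f x == f y) = (g x == g y)) -> #|f @: A| = #|g @: A|.
Proof.
move=> fg; apply/eqP; rewrite eqn_leq; apply/andP.
by split; apply: leq_card_factor_imset => x y /eqP; rewrite (fg, =^~ fg) => /eqP.
Qed.

(** * Partitions of a finite type, seen as kernels of maps *)

Section Partitions.

Variable T : finType.
Implicit Types (P Q : {set {set T}}) (x y : T).

(** The second argument is the coarser one, and equality is allowed. *)
Definition coarser P Q : bool :=
  [forall x, forall y, (pblock P x == pblock P y) ==> (pblock Q x == pblock Q y)].

Lemma coarserP P Q :
  reflect (forall x y, pblock P x = pblock P y -> pblock Q x = pblock Q y)
          (coarser P Q).
Proof.
apply: (iffP forallP) => [PQ x y /eqP Pxy | PQ x].
  by have /forallP/(_ y)/implyP/(_ Pxy)/eqP := PQ x.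
by apply/forallP => y; apply/implyP => /eqP /PQ ->.
Qed.

Lemma partition_pblock_imset P :
  partition P [set: T] -> P = pblock P @: [set: T].
Proof.
move=> partP; have covP := cover_partition partP.
apply/setP=> B; apply/idP/imsetP => [PB | [x _ ->]]; last first.
  by rewrite pblock_mem // covP.
have /set0Pn[x Bx] := partition_neq0 partP PB.
by exists x; rewrite // (def_pblock (partition_trivIset partP) PB Bx).
Qed.

Lemma eq_partition P Q :
    partition P [set: T] -> partition Q [set: T] ->
    (forall x y, (pblock P x == pblock P y) = (pblock Q x == pblock Q y)) ->
  P = Q.
Proof.
move=> partP partQ PQ.
rewrite -(preim_partition_pblock partP) -(preim_partition_pblock partQ).
by apply: eq_in_imset => x _; apply/setP => y; rewrite !inE PQ.
Qed.

Lemma eq_pblock_preim_partition (rT : eqType) (f : T -> rT) x y :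
  (pblock (preim_partition f [set: T]) x == pblock (preim_partition f [set: T]) y)
    = (f x == f y).
Proof.
have partf := preim_partitionP f [set: T].
rewrite eq_pblock ?(partition_trivIset partf) ?(cover_partition partf) //.
by rewrite pblock_equivalence_partition // => *; split=> // /eqP->.
Qed.

Lemma card_preim_partition (rT : finType) (f : T -> rT) :
  #|preim_partition f [set: T]| = #|f @: [set: T]|.
Proof.
rewrite {1}(partition_pblock_imset (preim_partitionP f _)).
exact/eq_card_kernel_imset/eq_pblock_preim_partition.
Qed.

(** The map [pblock Q] factors through [pblock P]; equal cardinalities make the induced map on
    classes injective, so the two kernels agree. *)
Lemma coarser_card_leqif P Q :
    partition P [set: T] -> partition Q [set: T] -> coarser P Q ->
  #|Q| <= #|P| ?= iff (Q == P).
Proof.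
move=> partP partQ /coarserP PQ.
have eQ := congr1 (fun R => #|pred_of_set R|) (partition_pblock_imset partQ).
have eP := congr1 (fun R => #|pred_of_set R|) (partition_pblock_imset partP).
split; rewrite eQ eP.
  exact: leq_card_factor_imset PQ.
apply/eqP/eqP => [/(eq_card_factor_imset PQ) QP | -> //].
apply: eq_partition => // x y.
by apply/eqP/eqP => [/QP -> | /PQ]; rewrite ?inE.
Qed.

Lemma coarser_refl P : coarser P P.
Proof. exact/coarserP. Qed.

Definition singletons : {set {set T}} := preim_partition id [set: T].

Lemma singletons_partition : partition singletons [set: T].
Proof. exact: preim_partitionP. Qed.

Lemma coarser_singletons P : coarser singletons P.
Proof. by apply/coarserP => x y /eqP; rewrite eq_pblock_preim_partition => /eqP ->. Qed.

Lemma card_singletons : #|singletons| = #|T|.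
Proof. by rewrite card_preim_partition imset_id cardsT. Qed.

Lemma partition_card_le P : partition P [set: T] -> #|P| <= #|T|.
Proof.
move=> partP; rewrite -card_singletons.
exact: (coarser_card_leqif singletons_partition partP (coarser_singletons P)).
Qed.

Lemma partition_card_gt0 P (x0 : T) : partition P [set: T] -> 0 < #|P|.
Proof.
move=> partP; rewrite card_gt0; apply/set0Pn; exists (pblock P x0).
by rewrite pblock_mem // (cover_partition partP).
Qed.

(** Numbering the classes gives [f], and choosing a representative in each gives its section [g]. *)
Lemma partition_quotient P (x0 : T) : partition P [set: T] ->
  exists (f : T -> 'I_#|P|) (g : 'I_#|P| -> T),
    cancel g f /\ forall x y, (f x == f y) = (pblock P x == pblock P y).
Proof.
move=> partP; have trivP := partition_trivIset partP.
have PP x : pblock P x \in P by rewrite pblock_mem ?(cover_partition partP).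
pose f x := enum_rank_in (PP x0) (pblock P x).
(* The default [x0] is never returned, since classes are non-empty. *)
exists f, (fun i : 'I_#|P| => odflt x0 [pick x in (enum_val i : {set T})]); split=> [i | x y].
  have Pi := enum_valP i; have /set0Pn[z zi] := partition_neq0 partP Pi.
  case: pickP => [x xi | /(_ z)/=]; last by rewrite zi.
  by rewrite /f /= (def_pblock trivP Pi xi) enum_valK_in.
by rewrite (can_in_eq (enum_rankK_in (PP x0))) ?PP.
Qed.

End Partitions.

(** Since [U] is the quotient of [T] by [P], pulling back along [f] and along [g] are inverse
    bijections between partitions of [U] and partitions coarser than [P]; surjectivity of [f]
    preserves the number of classes. *)
Lemma sum_coarser (T U : finType) (P : {set {set T}}) (f : T -> U) (g : U -> T)
    (F : nat -> nat) :
    cancel g f -> (forall x y, (f x == f y) = (pblock P x == pblock P y)) ->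
  \sum_(Q : {set {set T}} | partition Q [set: T] && coarser P Q) F #|Q|
    = \sum_(R : {set {set U}} | partition R [set: U]) F #|R|.
Proof.
move=> gK fP.
pose pull (R : {set {set U}}) := preim_partition (pblock R \o f) [set: T].
pose push (Q : {set {set T}}) := preim_partition (pblock Q \o g) [set: U].
have pushK Q : partition Q [set: T] && coarser P Q -> pull (push Q) = Q.
  case/andP=> partQ /coarserP PQ.
  apply: eq_partition => // [|x y]; first exact: preim_partitionP.
  (* The points [g (f z)] and [z] have the same image under [f], hence lie in one class of [P]. *)
  have Qgf z : pblock Q (g (f z)) = pblock Q z.
    by apply/PQ/eqP; rewrite -fP gK.
  by rewrite !eq_pblock_preim_partition /= !Qgf.
have pullK R : partition R [set: U] -> push (pull R) = R.
  move=> partR; apply: eq_partition => // [|x y]; first exact: preim_partitionP.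
  by rewrite !eq_pblock_preim_partition /= !gK.
rewrite (reindex_onto pull push) //; apply: eq_big => [R | R /andP[_ /eqP pR]].
  (* A family fixed by [push] after [pull] is a partition because every value of [push] is one. *)
  rewrite preim_partitionP /=; apply/andP/idP => [[_ /eqP <-] | partR].
    exact: preim_partitionP.
  rewrite pullK ?eqxx //; split=> //; apply/coarserP => x y /eqP.
  by rewrite -fP => /eqP fxy; apply/eqP; rewrite eq_pblock_preim_partition /= fxy.
have partR : partition R [set: U] by rewrite -pR; apply: preim_partitionP.
rewrite card_preim_partition imset_comp; congr (F #|pred_of_set _|).
have -> : f @: [set: T] = [set: U].
  by apply/setP => u; rewrite inE; apply/imsetP; exists (g u); rewrite ?gK.
by rewrite -partition_pblock_imset.
Qed.

(** * Counting hypergraphs by their vertex classes *)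

Section VertexClasses.

Variables (K : hkind) (p : hproperty K) (m n : nat).
Implicit Types (H : hypergraph K m n) (P Q : {set {set 'I_n}}).

(** This presents the relation [vsim] as the kernel of a map; multiplicities of edges do not affect
    it. *)
Definition star H (u : 'I_n) : {set {set 'I_n}} := [set e | is_edge H e & u \in e].

Lemma vsim_star H u v : vsim H u v = (star H u == star H v).
Proof.
apply/forallP/eqP => [uv | /setP uv e].
  by apply/setP => e; rewrite !inE; case: is_edge (uv e) => //= /eqP.
by apply/implyP => He; move: (uv e); rewrite !inE He /= => ->.
Qed.

Definition vclasses H : {set {set 'I_n}} := preim_partition (star H) [set: 'I_n].

Lemma vclasses_partition H : partition (vclasses H) [set: 'I_n].
Proof. exact: preim_partitionP. Qed.

Lemma eq_pblock_vclasses H u v :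
  (pblock (vclasses H) u == pblock (vclasses H) v) = vsim H u v.
Proof. by rewrite eq_pblock_preim_partition vsim_star. Qed.

Lemma is_T0_vclasses H : is_T0 H = (vclasses H == singletons 'I_n).
Proof.
apply/idP/eqP => [T0 | eqH].
  apply: eq_partition => [||u v]; first exact: vclasses_partition.
    exact: singletons_partition.
  rewrite eq_pblock_vclasses eq_pblock_preim_partition /=.
  apply/idP/eqP => [uv | ->]; last by rewrite vsim_star.
  apply: contraTeq uv => uv.
  by have /forallP/(_ u)/forallP/(_ v)/implyP/(_ uv) := T0.
apply/forallP => u; apply/forallP => v; apply/implyP.
by rewrite -eq_pblock_vclasses eqH eq_pblock_preim_partition.
Qed.

Lemma coarser_vclasses H P : partition P [set: 'I_n] ->
  [forall B in P, forall i in B, forall j in B, vsim H i j] = coarser P (vclasses H).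
Proof.
move=> partP; have trivP := partition_trivIset partP.
have covP x : x \in cover P by rewrite (cover_partition partP).
apply/idP/coarserP => [/'forall_in_'forall_in_forall_inP PH x y /eqP | PH].
  rewrite eq_pblock // => Pxy; apply/eqP; rewrite eq_pblock_vclasses.
  by apply: (PH (pblock P x)); rewrite ?pblock_mem ?mem_pblock.
apply/'forall_in_'forall_in_forall_inP => B PB i Bi j Bj.
rewrite -eq_pblock_vclasses; apply/eqP/PH.
by rewrite !(def_pblock trivP PB).
Qed.

Definition alpha_exact P : nat := #|[set H : hypergraph K m n | p H & vclasses H == P]|.

Lemma alpha_T0_exact : alpha_T0 p m n = alpha_exact (singletons 'I_n).
Proof. by apply: eq_card => H; rewrite !inE is_T0_vclasses. Qed.

Lemma alpha_part_exact P : partition P [set: 'I_n] ->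
  alpha_part p m P
    = \sum_(Q : {set {set 'I_n}} | partition Q [set: 'I_n] && coarser P Q) alpha_exact Q.
Proof.
move=> partP; rewrite /alpha_part -sum1_card.
rewrite (partition_big vclasses
           (fun Q => partition Q [set: 'I_n] && coarser P Q)) /= => [|H].
  apply: eq_bigr => Q /andP[_ PQ]; rewrite sum1_card; apply: eq_card => H.
  rewrite !inE -[in LHS]topredE /= inE coarser_vclasses //.
  by rewrite -andbA; congr andb; case: eqP => [->|]; rewrite ?PQ ?andbF.
by rewrite inE vclasses_partition coarser_vclasses // => /andP[].
Qed.

Lemma alpha_exact_sum :
  alpha p m n = \sum_(P : {set {set 'I_n}} | partition P [set: 'I_n]) alpha_exact P.
Proof.
(* The finest partition imposes no condition on the hypergraph. *)
transitivity (alpha_part p m (singletons 'I_n)).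
  apply: eq_card => H; rewrite !inE coarser_vclasses ?singletons_partition //.
  by rewrite coarser_singletons andbT.
rewrite alpha_part_exact ?singletons_partition //.
by apply: eq_bigl => P; rewrite coarser_singletons andbT.
Qed.

End VertexClasses.

Lemma alpha_exact_T0 (K : hkind) (p : hproperty K) (m n : nat) (P : {set {set 'I_n}}) :
    allows_T0_filtration p -> 0 < n -> partition P [set: 'I_n] ->
  alpha_exact p m P = alpha_T0 p m #|P|.
Proof.
(* The induction generalizes [n], because it is also applied to partitions of ['I_#|P|]. *)
case=> _ filt; have [k] := ubnP #|P|.
elim: k n P => // k IH n P; rewrite ltnS => leP n_gt0 partP.
have [f [g [gK fP]]] := partition_quotient (Ordinal n_gt0) partP.
have P_gt0 := partition_card_gt0 (Ordinal n_gt0) partP.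
have P_le := partition_card_le partP; rewrite card_ord in P_le.
(* A strictly coarser partition has fewer classes. This serves twice: below [P] on ['I_n] and below
   the singletons [D] on ['I_#|P|]. *)
have IHlt n' (Q Q' : {set {set 'I_n'}}) : 0 < n' -> #|Q'| = #|P| ->
    partition Q' [set: 'I_n'] -> partition Q [set: 'I_n'] && coarser Q' Q && (Q != Q') ->
  alpha_exact p m Q = alpha_T0 p m #|Q|.
  move=> n'_gt0 Q'P partQ' /andP[/andP[partQ Q'Q] neqQ]; apply: IH => //.
  by rewrite (leq_trans _ leP) // -Q'P (ltn_leqif (coarser_card_leqif _ _ Q'Q)).
pose D := singletons 'I_#|P|.
have partD : partition D [set: 'I_#|P|] := singletons_partition _.
have cardD : #|D| = #|P| by rewrite card_singletons card_ord.
have alphaD : alpha p m #|P|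
    = \sum_(R : {set {set 'I_#|P|}} | partition R [set: 'I_#|P|]) alpha_T0 p m #|R|.
  rewrite alpha_exact_sum (bigD1 D) // [RHS](bigD1 D) //= -alpha_T0_exact cardD.
  congr (_ + _); apply: eq_bigr => R /andP[partR neqR].
  by apply: (IHlt _ _ D); rewrite // partR coarser_singletons.
(* Filtration at [k = #|P|] equates two sums over the partitions coarser than [P]; only their terms
   at [P] are not yet known to agree. *)
have := filt m n #|P| n_gt0; rewrite P_gt0 P_le => /(_ isT P partP erefl).
rewrite alphaD -(sum_coarser (alpha_T0 p m) gK fP) alpha_part_exact //.
have PP : partition P [set: 'I_n] && coarser P P by rewrite partP coarser_refl.
rewrite (bigD1 P) // [RHS](bigD1 P) //=.
rewrite (eq_bigr (fun Q : {set {set 'I_n}} => alpha_T0 p m #|Q|)) => [|Q QP].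
  exact: addIn.
exact: (IHlt _ _ P).
Qed.

Theorem theorem3p5 (K : hkind) (p : hproperty K)
    (hp : allows_T0_filtration p) (m n : nat) (hn : 1 <= n) :
  alpha p m n = \sum_(1 <= i < n.+1) stirling2 n i * alpha_T0 p m i.
Proof.
rewrite alpha_exact_sum.
rewrite (eq_bigr (fun P : {set {set 'I_n}} => alpha_T0 p m #|P|)) => [|P partP];
  last exact: alpha_exact_T0.
(* Each inner sum has exactly one term, as [#|P|] lies between 1 and [n]; exchanging the sums then
   groups partitions by their number of classes. *)
transitivity (\sum_(P : {set {set 'I_n}} | partition P [set: 'I_n])
                \sum_(1 <= i < n.+1 | i == #|P|) alpha_T0 p m i).
  apply: eq_bigr => P partP; rewrite big_nat1_eq ltnS.
  have := partition_card_le partP; rewrite card_ord => ->.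
  by rewrite (partition_card_gt0 (Ordinal hn)).
rewrite (exchange_big_dep xpredT) //=; apply: eq_bigr => i _.
rewrite sum_nat_const; congr (_ * _); apply: eq_card => P.
by rewrite !inE eq_sym.
Qed.
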